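(* Let $\Xi\subset\mathbb{R}^N$ be compact, convex, with non-empty interior, and suppose Assumptions 1 and 2 (stated in the context, with constants $\mu$ and $\delta>0$ and static solution $(u_\delta,v_\delta)$) hold. Let $\Omega$ be a pole-set of $\Xi$ such that $d(\Omega,\Xi)=\epsilon\le\frac{\delta}{\mu}$, and let $u^*$ be the first-stage part of an optimal solution of the FARC problem for $\Xi'_{z_\Omega}$ (so that $c^Tu^*$ is the fully adjustable robust cost with respect to $\Xi'_{z_\Omega}$). Then $$\Pi_\Xi(I,\Omega)\ \le\ \Big(1-\frac{\epsilon\mu}{\delta}\Big)c^Tu^*+\frac{\epsilon\mu}{\delta}\,c^Tu_\delta .$$
   Context: Setting: $m,n,q\ge 1$ are integers, $V\in\mathbb{R}^{m\times q}$ and $c\in\mathbb{R}^n$ are fixed. An uncertain parameter is $\xi\equiv[U_\xi,b_\xi]$ with $U_\xi\in\mathbb{R}^{m\times n}$, $b_\xi\in\mathbb{R}^m$, identified with a vector of $\mathbb{R}^N$, $N=m(n+1)$, with Euclidean norm $\|\cdot\|_2$. Vector inequalities are componentwise. FARC for a compact convex set $X\subset\mathbb{R}^N$: minimize $c^Tu$ over $u\in\mathbb{R}^n$ and arbitrary functions $v:X\to\mathbb{R}^q$ subject to $U_\xi u+Vv(\xi)\le b_\xi$ for all $\xi\in X$. A pole-set of $\Xi$ is a finite set $\Omega\subset\mathbb{R}^N$ with $\Xi\subseteq\operatorname{conv}\Omega$. For $\xi\in\Xi$, $\Lambda_\xi=\{\lambda\in\mathbb{R}^\Omega_{\ge0}:\sum_\omega\lambda_\omega\omega=\xi,\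 \sum_\omega\lambda_\omega=1\}$. The multipolar robust value $\Pi_\Xi(I,\Omega)$ is the infimum of $c^Tu$ over $u\in\mathbb{R}^n$, $v_\omega\in\mathbb{R}^q$ ($\omega\in\Omega$) subject to $U_\xi u+V\sum_\omega\lambda_\omega v_\omega\le b_\xi$ for all $\xi\in\Xi$, $\lambda\in\Lambda_\xi$. $d(\Omega,\Xi)=\max_{\omega\in\Omega}\min_{\xi\in\Xi}\|\omega-\xi\|_2$. For a pole-set $\Omega$ and $\omega\in\Omega$, $z_\omega$ is the Euclidean projection of $\omega$ on $\Xi$, and $\Xi'_{z_\Omega}=\operatorname{conv}\{z_\omega:\omega\in\Omega\}\subseteq\Xi$. Assumption 1: there is a constant $\mu$ such that $\|(u^*,1)\|_2\le\mu$ for every pole-set $\Omega$ of $\Xi$ and every first-stage part $u^*\in\mathbb{R}^n$ of an optimal solution of the FARC problem for $\Xi'_{z_\Omega}$. Assumption 2: for some $\delta>0$, with $\Xi_\delta=\{[U,b]:\exists\,[U,b']\in\Xi,\ \|b-b'\|_\infty\le\delta\}$, there exists a static robust solution with respect to $\Xi_\delta$, i.e. $(u_\delta,v_\delta)\in\mathbb{R}^n\times\mathbb{R}^q$ with $Uu_\delta+Vv_\delta\le b$ for all $[U,b]\in\Xi_\delta$. *)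

(* Defs.v *)
From mathcomp Require Export all_boot all_order all_algebra.
From mathcomp Require Export finmap.
From mathcomp Require Export all_classical all_reals all_analysis.

Set Implicit Arguments.
Unset Strict Implicit.
Unset Printing Implicit Defensive.

Export Order.TTheory GRing.Theory Num.Theory.
Export numFieldNormedType.Exports.

#[global] Open Scope classical_set_scope.
#[global] Open Scope ring_scope.

(* An uncertain parameter xi = [U_xi, b_xi] is a block matrix in
   'M[R]_(m, n + 1), i.e. a point of R^N with N = m(n+1). *)
Definition Upart {R : realType} {m n : nat} (xi : 'M[R]_(m, n + 1)) :
  'M[R]_(m, n) := lsubmx xi.

Definition bpart {R : realType} {m n : nat} (xi : 'M[R]_(m, n + 1)) :
  'cV[R]_m := rsubmx xi.

Definition cvle {R : realType} {m : nat} (x y : 'cV[R]_m) : Prop :=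
  forall i, x i 0 <= y i 0.

(* The library norm `|A| on matrices is the sup norm. *)
Definition norm2 {R : realType} {p k : nat} (A : 'M[R]_(p, k)) : R :=
  Num.sqrt (\sum_i \sum_j A i j ^+ 2).

Definition cost {R : realType} {n : nat} (c u : 'cV[R]_n) : R :=
  (c^T *m u) 0 0.

Definition convex_hull {R : realType} {E : lmodType R} (A : set E) : set E :=
  smallest (fun B : set E => convex_set (B : set (convex_lmodType E))) A.

(* The second stage v is a total function, but only its restriction to X is
   constrained. *)
Definition farc_feasible {R : realType} {m n q : nat} (V : 'M[R]_(m, q))
    (X : set 'M[R]_(m, n + 1)) (u : 'cV[R]_n)
    (v : 'M[R]_(m, n + 1) -> 'cV[R]_q) : Prop :=
  forall xi, X xi -> cvle (Upart xi *m u + V *m v xi) (bpart xi).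

Definition farc_optimal {R : realType} {m n q : nat} (V : 'M[R]_(m, q))
    (c : 'cV[R]_n) (X : set 'M[R]_(m, n + 1)) (u : 'cV[R]_n)
    (v : 'M[R]_(m, n + 1) -> 'cV[R]_q) : Prop :=
  farc_feasible V X u v /\
  forall u' v', farc_feasible V X u' v' -> cost c u <= cost c u'.

Definition farc_first_stage {R : realType} {m n q : nat} (V : 'M[R]_(m, q))
    (c : 'cV[R]_n) (X : set 'M[R]_(m, n + 1)) (u : 'cV[R]_n) : Prop :=
  exists v, farc_optimal V c X u v.

Definition pole_set {R : realType} {m n : nat} (Xi : set 'M[R]_(m, n + 1))
    (Omega : {fset 'M[R]_(m, n + 1)}) : Prop :=
  Xi `<=` convex_hull [set` Omega].

Definition Lambda {R : realType} {m n : nat}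
    (Omega : {fset 'M[R]_(m, n + 1)}) (xi : 'M[R]_(m, n + 1)) :
    set (Omega -> R) :=
  [set lam | [/\ forall w, 0 <= lam w,
                 \sum_(w : Omega) lam w *: val w = xi
               & \sum_(w : Omega) lam w = 1]].

Definition multipolar_feasible {R : realType} {m n q : nat} (V : 'M[R]_(m, q))
    (Xi : set 'M[R]_(m, n + 1)) (Omega : {fset 'M[R]_(m, n + 1)})
    (u : 'cV[R]_n) (v : Omega -> 'cV[R]_q) : Prop :=
  forall xi, Xi xi -> forall lam, Lambda xi lam ->
    cvle (Upart xi *m u + V *m (\sum_(w : Omega) lam w *: v w)) (bpart xi).

(* Extended-real infimum: +oo if infeasible, -oo if unbounded. *)
Definition multipolar_value {R : realType} {m n q : nat} (V : 'M[R]_(m, q))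
    (c : 'cV[R]_n) (Xi : set 'M[R]_(m, n + 1))
    (Omega : {fset 'M[R]_(m, n + 1)}) : \bar R :=
  ereal_inf [set (cost c u)%:E | u in
    [set u | exists v : Omega -> 'cV[R]_q, multipolar_feasible V Xi u v]].

(* For compact non-empty Xi the infimum is attained; distances being
   nonnegative, the neutral element 0 does not affect the maximum. *)
Definition pole_dist {R : realType} {m n : nat}
    (Omega : {fset 'M[R]_(m, n + 1)}) (Xi : set 'M[R]_(m, n + 1)) : R :=
  \big[Num.max/0]_(w : Omega) inf [set norm2 (val w - xi) | xi in Xi].

(* Well defined for Xi non-empty, closed and convex, in which case the nearest
   point exists and is unique. *)
Definition eproj {R : realType} {m n : nat} (Xi : set 'M[R]_(m, n + 1))
    (w : 'M[R]_(m, n + 1)) : 'M[R]_(m, n + 1) :=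
  get [set z | Xi z /\ forall xi, Xi xi -> norm2 (w - z) <= norm2 (w - xi)].

Definition proj_hull {R : realType} {m n : nat} (Xi : set 'M[R]_(m, n + 1))
    (Omega : {fset 'M[R]_(m, n + 1)}) : set 'M[R]_(m, n + 1) :=
  convex_hull (eproj Xi @` [set` Omega]).

Definition assumption1 {R : realType} {m n q : nat} (V : 'M[R]_(m, q))
    (c : 'cV[R]_n) (Xi : set 'M[R]_(m, n + 1)) (mu : R) : Prop :=
  forall Omega : {fset 'M[R]_(m, n + 1)}, pole_set Xi Omega ->
  forall u : 'cV[R]_n, farc_first_stage V c (proj_hull Xi Omega) u ->
    norm2 (col_mx u (1%:M : 'cV[R]_1)) <= mu.

Definition b_enlargement {R : realType} {m n : nat}
    (Xi : set 'M[R]_(m, n + 1)) (delta : R) : set 'M[R]_(m, n + 1) :=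
  [set xi | exists2 xi', Xi xi' &
     Upart xi = Upart xi' /\ `|bpart xi - bpart xi'| <= delta].

Definition static_robust {R : realType} {m n q : nat} (V : 'M[R]_(m, q))
    (X : set 'M[R]_(m, n + 1)) (u : 'cV[R]_n) (v : 'cV[R]_q) : Prop :=
  forall xi, X xi -> cvle (Upart xi *m u + V *m v) (bpart xi).

(* Main.v *)
Require Import Defs.
From mathcomp Require Import ring lra.

Set Implicit Arguments.
Unset Strict Implicit.
Unset Printing Implicit Defensive.

(** With [t = eps * mu / delta], the convex combination of weights [1 - t] and
    [t] of the policy [(ustar, v (z_w))_w] and of the static policy
    [(udelta, vdelta)] is multipolar feasible: moving the poles to their
    projections violates each constraint of the former by at most [eps * mu],
    while the latter leaves a slack [delta] in each constraint, and
    [(1 - t) * (eps * mu) <= t * delta]. *)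

(** Lagrange's identity: the double sum of the squares of [a i * b j - a j * b i] is twice the gap
    between the two sides. *)
Lemma sum_cauchy_schwarz (R : realDomainType) (I : finType) (a b : I -> R) :
  (\sum_i a i * b i) ^+ 2 <= (\sum_i a i ^+ 2) * (\sum_i b i ^+ 2).
Proof.
have : 0 <= \sum_i \sum_j (a i * b j - a j * b i) ^+ 2.
  by apply: sumr_ge0 => i _; apply: sumr_ge0 => j _; exact: sqr_ge0.
set A := \sum_i a i ^+ 2; set B := \sum_i b i ^+ 2; set C := \sum_i a i * b i.
suff -> : \sum_i \sum_j (a i * b j - a j * b i) ^+ 2 =
    A * B + B * A - (C * C) *+ 2 by lra.
rewrite /A /B /C !big_distrlr /= -sumrMnl -big_split -sumrB /=.
apply: eq_bigr => i _; rewrite -sumrMnl -big_split -sumrB /=.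
by apply: eq_bigr => j _; ring.
Qed.

(** Cauchy-Schwarz on row [i], whose squared norm is one of the summands in that of [A]. *)
Lemma mulmx_le_norm2 (R : realType) (p k : nat) (A : 'M[R]_(p, k))
    (x : 'cV[R]_k) (i : 'I_p) :
  (A *m x) i 0 <= norm2 A * norm2 x.
Proof.
apply: le_trans (ler_norm _) _; rewrite -sqrtr_sqr /norm2 -sqrtrM; last first.
  by apply: sumr_ge0 => ? _; apply: sumr_ge0 => ? _; exact: sqr_ge0.
apply: ler_wsqrtr; rewrite mxE.
apply: le_trans (sum_cauchy_schwarz (A i) (x^~ 0)) _.
have -> : \sum_j \sum_l x j l ^+ 2 = \sum_j x j 0 ^+ 2.
  by apply: eq_bigr => j _; rewrite big_ord1.
apply: ler_wpM2r; first by apply: sumr_ge0 => ? _; exact: sqr_ge0.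
rewrite [leRHS](bigD1 i) //= lerDl.
by apply: sumr_ge0 => ? _; apply: sumr_ge0 => ? _; exact: sqr_ge0.
Qed.

Lemma norm2_dist_continuous (R : realType) (p k : nat) (w : 'M[R]_(p, k)) :
  continuous (fun z : 'M[R]_(p, k) => norm2 (w - z)).
Proof.
have norm2E : (fun z => norm2 (w - z)) =
    Num.sqrt \o (fun z => \sum_i \sum_j (w - z) i j ^+ 2) by [].
rewrite norm2E => z; apply: continuous_comp; last exact: sqrt_continuous.
move: z.
apply: (continuous_big (op := +%R)) => [|i _]; first exact: add_continuous.
apply: (continuous_big (op := +%R)) => [|j _]; first exact: add_continuous.
have cont_ij : continuous (fun z : 'M[R]_(p, k) => (w - z) i j).
  have -> : (fun z : 'M[R]_(p, k) => (w - z) i j) =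
      cst (w i j) - (fun z => z i j).
    by apply/funext => z; rewrite /= !mxE.
  move=> z; apply: continuousB; first exact: cst_continuous.
  exact: coord_continuous.
by move=> z; apply: continuousM; exact: cont_ij.
Qed.

(** The continuous distance to [w] attains its minimum on the compact [Xi], so [get] never falls
    back on its default value. *)
Lemma eprojP (R : realType) (m n : nat) (Xi : set 'M[R]_(m, n + 1))
    (w : 'M[R]_(m, n + 1)) : compact Xi -> Xi !=set0 ->
  Xi (eproj Xi w) /\
  forall xi, Xi xi -> norm2 (w - eproj Xi w) <= norm2 (w - xi).
Proof.
move=> cXi Xi0; rewrite /eproj; case: xgetP => [z _ [Xiz zmin] //|noz].
have [|z zXi zmin] := compact_EVT_min Xi0 cXi
  (f := fun z : 'M[R]_(m, n + 1) => norm2 (w - z)).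
  exact/continuous_subspaceT/norm2_dist_continuous.
case: (noz z); split; first exact: set_mem.
by move=> xi Xixi; apply: zmin; exact: mem_set.
Qed.

Lemma norm2_sub_eproj (R : realType) (m n : nat) (Xi : set 'M[R]_(m, n + 1))
    (Omega : {fset 'M[R]_(m, n + 1)}) (w : Omega) :
  compact Xi -> Xi !=set0 ->
  norm2 (val w - eproj Xi (val w)) <= pole_dist Omega Xi.
Proof.
move=> cXi Xi0; have [_ zmin] := eprojP (val w) cXi Xi0.
apply: le_trans (le_bigmax _ _ w); apply: lb_le_inf.
  by case: Xi0 => xi Xixi; exists (norm2 (val w - xi)), xi.
by move=> _ [xi Xixi <-]; exact: zmin.
Qed.

Lemma eproj_in_proj_hull (R : realType) (m n : nat)
    (Xi : set 'M[R]_(m, n + 1)) (Omega : {fset 'M[R]_(m, n + 1)})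
    (w : Omega) :
  proj_hull Xi Omega (eproj Xi (val w)).
Proof. by apply: sub_gen_smallest; exists (val w) => //=; exact: valP. Qed.

Lemma norm2_col_mx_1 (R : realType) (n : nat) (u : 'cV[R]_n) :
  norm2 (col_mx u (- 1%:M : 'cV[R]_1)) = norm2 (col_mx u (1%:M : 'cV[R]_1)).
Proof.
rewrite /norm2 !big_split_ord /=; congr (Num.sqrt (_ + _)).
  by apply: eq_bigr => i _; apply: eq_bigr => j _; rewrite !col_mxEu.
apply: eq_bigr => i _; apply: eq_bigr => j _.
by rewrite !col_mxEd [(- _ : 'M[_]_(_, _)) _ _]mxE sqrrN.
Qed.

(** Under [assumption1] this forces [mu] to be positive, so that [eps <= delta / mu] can be cleared
    of its denominator. *)
Lemma norm2_col_mx_1_ge1 (R : realType) (n : nat) (u : 'cV[R]_n) :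
  1 <= norm2 (col_mx u (1%:M : 'cV[R]_1)).
Proof.
rewrite -[leLHS]sqrtr1; apply: ler_wsqrtr.
rewrite big_split_ord /= [X in _ + X]big_ord1 [X in _ + X]big_ord1.
rewrite col_mxEd mxE eqxx expr1n lerDr.
by apply: sumr_ge0 => ? _; apply: sumr_ge0 => ? _; exact: sqr_ge0.
Qed.

(** Homogenization: pairing with [(u, -1)] makes the first-stage part of a constraint, right-hand
    side included, linear in [xi]. *)
Lemma mul_col_mx_opp1 (R : realType) (m n : nat) (xi : 'M[R]_(m, n + 1))
    (u : 'cV[R]_n) :
  xi *m col_mx u (- 1%:M) = Upart xi *m u - bpart xi.
Proof.
by rewrite -{1}[xi]hsubmxK mul_row_col mulmxN mulmx1.
Qed.

(** The enlargement contains [xi] with every entry of its right-hand side lowered by [delta]; the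
    static policy satisfies that tighter constraint too. *)
Lemma static_robust_slack (R : realType) (m n q : nat) (V : 'M[R]_(m, q))
    (Xi : set 'M[R]_(m, n + 1)) (delta : R) (u : 'cV[R]_n) (v : 'cV[R]_q) :
  0 <= delta -> static_robust V (b_enlargement Xi delta) u v ->
  forall xi, Xi xi -> forall i,
    (Upart xi *m u + V *m v) i 0 <= bpart xi i 0 - delta.
Proof.
move=> delta0 H xi Xixi i.
have := H (row_mx (Upart xi) (bpart xi - const_mx delta)).
rewrite /Upart /bpart row_mxKl row_mxKr => /(_ _ i); rewrite !mxE; apply.
exists xi => //; rewrite /Upart /bpart row_mxKl row_mxKr; split=> //.
rewrite addrAC subrr sub0r normrN; rewrite /Num.norm /= mx_normrE.
by apply/bigmax_leP; split=> [|j _]; rewrite ?mxE ?ger0_norm.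
Qed.

(* The violation is bounded at each single pole by Cauchy-Schwarz; constraints
   being affine, the bound survives convex combinations of poles. *)
Lemma pole_violation (R : realType) (m n q : nat) (V : 'M[R]_(m, q))
    (Xi : set 'M[R]_(m, n + 1)) (Omega : {fset 'M[R]_(m, n + 1)})
    (u : 'cV[R]_n) (v : 'M[R]_(m, n + 1) -> 'cV[R]_q) :
  compact Xi -> Xi !=set0 -> farc_feasible V (proj_hull Xi Omega) u v ->
  forall xi (lam : Omega -> R), Lambda xi lam -> forall i,
  (Upart xi *m u +
     V *m (\sum_(w : Omega) lam w *: v (eproj Xi (val w)))) i 0
    <= bpart xi i 0 +
       pole_dist Omega Xi * norm2 (col_mx u (1%:M : 'cV[R]_1)).
Proof.
move=> cXi Xi0 Hv xi lam [lam0 lamxi lam1] i.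
set e := pole_dist _ _ * _; set x := col_mx u (- 1%:M).
pose g (w : Omega) := val w *m x + V *m v (eproj Xi (val w)).
have ge w : g w i 0 <= e.
  have /(_ i) := Hv _ (eproj_in_proj_hull w).
  (* Split the pole into its displacement and its projection: feasibility at the projection makes
     the second term nonpositive, and the first is at most [e]. *)
  have -> : g w = (val w - eproj Xi (val w)) *m x +
      (eproj Xi (val w) *m x + V *m v (eproj Xi (val w))).
    by rewrite /g addrA -mulmxDl subrK.
  rewrite (mul_col_mx_opp1 (eproj _ _)) => Hz.
  have : ((val w - eproj Xi (val w)) *m x) i 0 <= e.
    apply: le_trans (mulmx_le_norm2 _ _ _) _; rewrite norm2_col_mx_1.
    by apply: ler_wpM2r; [exact: sqrtr_ge0 | exact: norm2_sub_eproj].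
  move: Hz; rewrite ![(_ + _ : 'M[_]_(_, _)) i 0]mxE
    ![(- _ : 'M[_]_(_, _)) i 0]mxE.
  lra.
have sumg : \sum_w lam w *: g w = xi *m x +
    V *m (\sum_(w : Omega) lam w *: v (eproj Xi (val w))).
  rewrite -lamxi mulmx_suml mulmx_sumr -big_split /=.
  by apply: eq_bigr => w _; rewrite scalerDr -scalemxAl -scalemxAr.
(* The weights sum to [1], so [e] is its own weighted average. *)
have : (\sum_w lam w *: g w) i 0 <= e.
  rewrite summxE -[leRHS]mul1r -lam1 mulr_suml; apply: ler_sum => w _.
  by rewrite mxE; apply: ler_wpM2l.
rewrite sumg mul_col_mx_opp1 ![(_ + _ : 'M[_]_(_, _)) i 0]mxE
    ![(- _ : 'M[_]_(_, _)) i 0]mxE.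
lra.
Qed.

Theorem theorem3 (R : realType) (m n q : nat)
    (hm : (0 < m)%N) (hn : (0 < n)%N) (hq : (0 < q)%N)
    (V : 'M[R]_(m, q)) (c : 'cV[R]_n)
    (Xi : set 'M[R]_(m, n + 1))
    (Xi_compact : compact Xi)
    (Xi_convex : convex_set (Xi : set (convex_lmodType 'M[R]_(m, n + 1))))
    (Xi_interior : Xi° !=set0)
    (mu : R) (Hmu : assumption1 V c Xi mu)
    (delta : R) (delta_gt0 : 0 < delta)
    (udelta : 'cV[R]_n) (vdelta : 'cV[R]_q)
    (Hdelta : static_robust V (b_enlargement Xi delta) udelta vdelta)
    (Omega : {fset 'M[R]_(m, n + 1)}) (HOmega : pole_set Xi Omega)
    (eps : R) (Heps : pole_dist Omega Xi = eps) (eps_le : eps <= delta / mu)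
    (ustar : 'cV[R]_n)
    (Hustar : farc_first_stage V c (proj_hull Xi Omega) ustar) :
  (multipolar_value V c Xi Omega <=
   ((1 - eps * mu / delta) * cost c ustar
    + (eps * mu / delta) * cost c udelta)%:E)%E.
Proof.
have Xi0 : Xi !=set0.
  by case: Xi_interior => x xXi; exists x; exact: interior_subset.
have mu_ge := Hmu _ HOmega _ Hustar.
have mu_gt0 : 0 < mu.
  by apply: lt_le_trans mu_ge; apply: lt_le_trans (norm2_col_mx_1_ge1 _).
have eps_ge0 : 0 <= eps by rewrite -Heps; exact: bigmax_ge_id.
case: Hustar => vstar [Hfeas _].
set t := eps * mu / delta.
have t0 : 0 <= t by rewrite /t divr_ge0 ?mulr_ge0 // ltW.
have t1 : t <= 1 by rewrite /t ler_pdivrMr // mul1r -ler_pdivlMr.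
have td : t * delta = eps * mu by rewrite /t divfK // gt_eqF.
(* The cost is linear, so this first stage costs exactly the claimed bound; only its feasibility
   remains. *)
apply: ereal_inf_lbound; exists ((1 - t) *: ustar + t *: udelta); last first.
  by rewrite /cost mulmxDr -!scalemxAr !mxE.
exists (fun w => (1 - t) *: vstar (eproj Xi (val w)) + t *: vdelta).
move=> xi Xixi lam Hlam i; have [lam0 _ lam1] := Hlam.
have Hstar := pole_violation Xi_compact Xi0 Hfeas Hlam i.
have Hst := static_robust_slack (ltW delta_gt0) Hdelta Xixi i.
set S := \sum_w lam w *: vstar (eproj Xi (val w)) in Hstar.
(* Since [lam] sums to [1], the static part [t *: vdelta] is unchanged by averaging over the
   poles. *)
have -> : \sum_(w : Omega)
    lam w *: ((1 - t) *: vstar (eproj Xi (val w)) + t *: vdelta) =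
    (1 - t) *: S + t *: vdelta.
  under eq_bigr do rewrite scalerDr scalerA mulrC -scalerA.
  by rewrite big_split /= -scaler_sumr -scaler_suml lam1 scale1r.
have -> : Upart xi *m ((1 - t) *: ustar + t *: udelta) +
    V *m ((1 - t) *: S + t *: vdelta) =
    (1 - t) *: (Upart xi *m ustar + V *m S) +
    t *: (Upart xi *m udelta + V *m vdelta).
  by rewrite !mulmxDr -!scalemxAr !scalerDr addrACA.
rewrite [(_ + _ : 'M[_]_(_, _)) i 0]mxE ![(_ *: _ : 'M[_]_(_, _)) i 0]mxE.
have Hstar' : (Upart xi *m ustar + V *m S) i 0 <= bpart xi i 0 + eps * mu.
  apply: le_trans Hstar _; rewrite lerD2l Heps; exact: ler_wpM2l.
have h1 : 0 <= 1 - t by rewrite subr_ge0.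
apply: le_trans (lerD (ler_wpM2l h1 Hstar') (ler_wpM2l t0 Hst)) _.
(* As [t * delta = eps * mu], the combined bound equals [bpart xi i 0 - t * (eps * mu)]. *)
have := mulr_ge0 t0 (mulr_ge0 eps_ge0 (ltW mu_gt0)).
rewrite mulrBr td; lra.
Qed.
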